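(* There exist permutons $\mu_1,\mu_2$ satisfying $\widetilde{\mathrm{sh}}(\mu_1)=\widetilde{\mathrm{sh}}(\mu_2)$ and $$\limsup_{n\to\infty}\frac1n\log\mathbf{P}\big(\mathrm{LIS}(\tau_n)<\beta n\big)<\liminf_{n\to\infty}\frac1n\log\mathbf{P}\big(\mathrm{LIS}(\sigma_n)<\beta n\big)$$ for some $\beta<\widetilde{\mathrm{LIS}}_1(\mu_1)$, where $\sigma_n\sim\mathrm{Sample}_n(\mu_1)$ and $\tau_n\sim\mathrm{Sample}_n(\mu_2)$ for each $n\in\mathbb{N}^*$.
   Context: $\mathbb{N}^*=\{1,2,\dots\}$. A permuton is a Borel probability measure on $[0,1]^2$ with both marginals uniform on $[0,1]$. Given points $Z_1,\dots,Z_n\in[0,1]^2$ with distinct $x$-coordinates and distinct $y$-coordinates, $\mathrm{Perm}(Z_1,\dots,Z_n)$ is the permutation $\sigma$ of $\{1,\dots,n\}$ with $\sigma(i)=j$ whenever the point with $i$-th lowest $x$-coordinate has $j$-th lowest $y$-coordinate. $\mathrm{Sample}_n(\mu)$ is the law of $\mathrm{Perm}(Z_1,\dots,Z_n)$ for $Z_1,\dots,Z_n$ i.i.d. with law $\mu$ (a.s. well defined). $\mathrm{LIS}(\sigma)$ is the maximal length of an increasing subsequence of the permutation $\sigma$. A subset $A\subset[0,1]^2$ is nondecreasing (resp. nonincreasing) if for all $(x_1,y_1),(x_2,y_2)\in A$, $(x_2-x_1)(y_2-y_1)\ge 0$ (resp. $\le 0$). It is $k$-nondecreasing (resp. $k$-nonincreasing)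 if it is a union of $k$ nondecreasing (resp. nonincreasing) subsets. For $k\in\mathbb{N}^*$, $\widetilde{\mathrm{LIS}}_k(\mu):=\sup_A \mu(A)$ over closed $k$-nondecreasing $A\subset[0,1]^2$, and $\widetilde{\mathrm{LDS}}_k(\mu):=\sup_A\mu(A)$ over closed $k$-nonincreasing $A$; $\widetilde{\mathrm{LIS}}_0(\mu)=\widetilde{\mathrm{LDS}}_0(\mu):=0$. Finally $$\widetilde{\mathrm{sh}}(\mu):=\Big(\big(\widetilde{\mathrm{LIS}}_k(\mu)-\widetilde{\mathrm{LIS}}_{k-1}(\mu)\big)_{k\in\mathbb{N}^*},\big(\widetilde{\mathrm{LDS}}_k(\mu)-\widetilde{\mathrm{LDS}}_{k-1}(\mu)\big)_{k\in\mathbb{N}^*}\Big).$$ *)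

(* Defs.v *)
From HB Require Import structures.
From mathcomp Require Import all_boot all_order all_algebra all_fingroup.
From mathcomp Require Import all_classical all_reals all_analysis.
From mathcomp Require Import measurable_realfun.

Set Implicit Arguments.
Unset Strict Implicit.
Unset Printing Implicit Defensive.
Import Order.TTheory GRing.Theory Num.Theory.
Import numFieldNormedType.Exports.

Local Open Scope classical_set_scope.
Local Open Scope ring_scope.

Section iid_samples.
Context d (T : measurableType d) (R : realType).

Definition tuple_cons n (p : T * n.-tuple T) : n.+1.-tuple T :=
  [the n.+1.-tuple T of p.1 :: p.2].

Lemma measurable_tuple_cons n : measurable_fun [set: T * n.-tuple T] (@tuple_cons n).
Proof. exact: measurable_cons. Qed.

HB.instance Definition _ n :=
  isMeasurableFun.Build _ _ _ _ (@tuple_cons n) (@measurable_tuple_cons n).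

(* The law of (Z_1, ..., Z_n) for Z_1, ..., Z_n i.i.d. with law mu, i.e. the
   n-fold product of mu. *)
Fixpoint iid (mu : probability T R) n : probability (n.-tuple T) R :=
  match n with
  | 0 => dirac [tuple]
  | m.+1 => distribution (mu \x iid mu m)%E (@tuple_cons m)
  end.

End iid_samples.

(* Permutations carry the discrete sigma-algebra. *)
HB.instance Definition _ (T : finType) := isPointed.Build (perm_type T) 1%g.
HB.instance Definition _ (T : finType) := @isMeasurable.Build default_measure_display
  (perm_type T) discrete_measurable discrete_measurable0
  discrete_measurableC discrete_measurableU.

Section perm_of_points.
Context (R : realType) (n : nat).
Implicit Type z : n.-tuple (R * R).

(* The 0-based rank of the i-th point by x-coordinate, resp. by y-coordinate. *)
Definition xrank z (i : 'I_n) : nat :=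
  #|[set j : 'I_n | (tnth z j).1 < (tnth z i).1]%SET|.
Definition yrank z (i : 'I_n) : nat :=
  #|[set j : 'I_n | (tnth z j).2 < (tnth z i).2]%SET|.

(* s maps the x-rank of each point to its y-rank; when the x-coordinates are
   distinct and the y-coordinates are distinct, exactly one s does. *)
Definition is_perm_of_points z (s : 'S_n) : bool :=
  [forall k : 'I_n, forall i : 'I_n, (i == xrank z k :> nat) ==> (s i == yrank z k :> nat)].

(* The value on tuples with a repeated coordinate is irrelevant: they form a
   null set for samples of a permuton. *)
Definition perm_of_points z : 'S_n := odflt 1%g [pick s | is_perm_of_points z s].

Lemma measurable_perm_of_points : measurable_fun [set: n.-tuple (R * R)] perm_of_points.
Proof.
pose cmp z := [ffun p : 'I_n * 'I_n =>
  ((tnth z p.1).1 < (tnth z p.2).1, (tnth z p.1).2 < (tnth z p.2).2)].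
pose g (c : {ffun 'I_n * 'I_n -> bool * bool}) : 'S_n :=
  odflt 1%g [pick s : 'S_n | [forall k : 'I_n, forall i : 'I_n,
    (i == #|[set j | (c (j, k)).1]%SET| :> nat) ==>
    (s i == #|[set j | (c (j, k)).2]%SET| :> nat)]].
have permE' z : perm_of_points z = g (cmp z).
  rewrite /perm_of_points /g; congr odflt; apply: eq_pick => s; rewrite /is_perm_of_points.
  apply: eq_forallb => k; apply: eq_forallb => i; rewrite /xrank /yrank.
  by congr ((_ == _ :> nat) ==> (_ == _ :> nat)); apply: eq_card => j;
    rewrite !inE ffunE.
have mlt (f : R * R -> R) (j k : 'I_n) : measurable_fun setT f ->
    measurable_fun setT (fun z => f (tnth z j) < f (tnth z k)).
  move=> mf; apply: measurable_fun_ltr;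
    by apply: (measurableT_comp mf); exact: measurable_tnth.
have mcmp c : measurable [set z | cmp z = c].
  have -> : [set z | cmp z = c] = \bigcap_(p in [set: 'I_n * 'I_n])
      ([set z | ((tnth z p.1).1 < (tnth z p.2).1) = (c p).1] `&`
       [set z | ((tnth z p.1).2 < (tnth z p.2).2) = (c p).2]).
    apply/seteqP; split => z /=.
      by move=> <- p _ /=; rewrite ffunE.
    move=> H; apply/ffunP => p; rewrite ffunE.
    by have [/= -> ->] := H p I; case: (c p).
  apply: fin_bigcap_measurable => // p _; apply: measurableI.
    have := mlt fst p.1 p.2 measurable_fst measurableT [set (c p).1] I.
    by rewrite setTI.
  have := mlt snd p.1 p.2 measurable_snd measurableT [set (c p).2] I.
  by rewrite setTI.
move=> _ A _; rewrite setTI.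
have -> : perm_of_points @^-1` A = \bigcup_(c in [set c | A (g c)]) [set z | cmp z = c].
  apply/seteqP; split => z /=; first by rewrite permE' => Az; exists (cmp z).
  by case=> c /= Ac cE; rewrite permE' cE.
by apply: fin_bigcup_measurable => // c _; exact: mcmp.
Qed.

HB.instance Definition _ := isMeasurableFun.Build _ _ _ _ perm_of_points measurable_perm_of_points.

End perm_of_points.

Definition Sample (R : realType) (n : nat) (mu : probability (R * R)%type R) :
  probability 'S_n R := distribution (iid mu n) (@perm_of_points R n).

Definition LIS n (s : 'S_n) : nat :=
  \max_(I : {set 'I_n} | [forall i in I, forall j in I, (i < j)%N ==> (s i < s j)%N]) #|I|.

Section permutons.
Context (R : realType).
Implicit Types (A : set (R * R)) (mu : probability (R * R)%type R).

Definition unit_square : set (R * R) := `[0, 1] `*` `[0, 1].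

(* Borel probability measures on [0, 1]^2 are encoded as Borel probability
   measures on R^2 carried by [0, 1]^2. *)
Definition is_permuton mu : Prop :=
  [/\ mu unit_square = 1%E,
      forall B : set R, measurable B ->
        pushforward mu fst B = uniform_prob (@ltr01 R) B &
      forall B : set R, measurable B ->
        pushforward mu snd B = uniform_prob (@ltr01 R) B].

Definition nondecreasing_set A : Prop :=
  forall p q, A p -> A q -> 0 <= (q.1 - p.1) * (q.2 - p.2).

Definition nonincreasing_set A : Prop :=
  forall p q, A p -> A q -> (q.1 - p.1) * (q.2 - p.2) <= 0.

Definition k_nondecreasing k A : Prop :=
  exists2 B : 'I_k -> set (R * R),
    (forall i, nondecreasing_set (B i)) & A = \bigcup_i B i.

Definition k_nonincreasing k A : Prop :=
  exists2 B : 'I_k -> set (R * R),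
    (forall i, nonincreasing_set (B i)) & A = \bigcup_i B i.

Definition LISt mu k : \bar R :=
  if k is 0 then 0%E else
  ereal_sup [set mu A | A in
    [set A | [/\ closed A, A `<=` unit_square & k_nondecreasing k A]]].

Definition LDSt mu k : \bar R :=
  if k is 0 then 0%E else
  ereal_sup [set mu A | A in
    [set A | [/\ closed A, A `<=` unit_square & k_nonincreasing k A]]].

(* Index k stands for k.+1 : the sequences of the shape are indexed from 1. *)
Definition sht mu : (nat -> \bar R) * (nat -> \bar R) :=
  (fun k => (LISt mu k.+1 - LISt mu k)%E, fun k => (LDSt mu k.+1 - LDSt mu k)%E).

(* (1/n) log P(LIS(sigma_n) < beta n) for sigma_n of law Sample n mu, equal to -oo when the probability is 0. *)
Definition lower_tail_rate mu (beta : R) (n : nat) : \bar R :=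
  ((n%:R^-1)%:E * lne (Sample n mu [set s : 'S_n | ((LIS s)%:R < beta * n%:R)%R]%classic))%E.

End permutons.

(* Main.v *)
Require Import Defs.
From HB Require Import structures.
From mathcomp Require Import all_boot all_order all_algebra all_fingroup.
From mathcomp Require Import all_classical all_reals all_analysis.
From mathcomp Require Import measurable_realfun zify ring lra.

(** Both permutons are laws of (U, f U) with U uniform and f an exchange of
  intervals fixing [0, s) and swapping [s, m) and [m, 1). As long as
  s + (1 - m) <= m, the increasing pieces give the shape LIS_1 = m, LIS_k = 1
  for k >= 2 and LDS_k = 0, whatever s is. With p = 1 - m = 2^-22 we compare
  s = 0 with s = m - p, at beta = 2/3.
  For s = 0 the LIS of the sample is the larger of the numbers of points in two
  blocks of masses m and p, so it suffices that the sample alternates between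
  the blocks, which has probability at least 2^(-12 n).
  For s = m - p it is the number of points in the first block plus the larger of
  the numbers in two blocks of mass p each, so LIS < 2n/3 forces more than 2n/3
  points into a set of mass 2p = 2^-21; by a union bound over at most 2^n sets of
  indices, this has probability at most 2^n 2^(-14 n) = 2^(-13 n). *)

Set Implicit Arguments.
Unset Strict Implicit.
Unset Printing Implicit Defensive.

Import Order.TTheory GRing.Theory Num.Theory.
Import numFieldNormedType.Exports.
Local Open Scope classical_set_scope.
Local Open Scope ring_scope.

(** * Increasing subsequences read off from the points of a sample *)

Section LIS_of_points.
Context (R : realType) (n : nat).

(** Strict lower sets of values are nested; when [f i < f j], the index [i] itself makes the
    inclusion proper. *)
Lemma ltn_rank (f : 'I_n -> R) (i j : 'I_n) :
  (#|[set k : 'I_n | (f k < f i)%R]%SET| < #|[set k : 'I_n | (f k < f j)%R]%SET|)%N =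
  (f i < f j).
Proof.
case: ltP => fij.
  apply: proper_card; apply/properP; split.
    by apply/fintype.subsetP => k; rewrite !inE => /lt_trans; apply.
  by exists i; rewrite inE ?fij ?ltxx.
apply/negbTE; rewrite -leqNgt; apply: subset_leq_card.
by apply/fintype.subsetP => k; rewrite !inE => /lt_le_trans; apply.
Qed.

Lemma rank_lt (f : 'I_n -> R) (i : 'I_n) :
  (#|[set k : 'I_n | (f k < f i)%R]%SET| < n)%N.
Proof.
rewrite -[X in (_ < X)%N]card_ord -cardsT; apply: proper_card.
by rewrite properT; apply/negP => /eqP/setP/(_ i); rewrite !inE ltxx.
Qed.

Definition rank_ord (f : 'I_n -> R) (i : 'I_n) : 'I_n := Ordinal (rank_lt f i).

Lemma rank_ord_inj (f : 'I_n -> R) : injective f -> injective (rank_ord f).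
Proof.
move=> finj i j /(congr1 val) /= rij; apply: finj; apply/eqP.
by rewrite eq_le !leNgt -!ltn_rank rij ltnn.
Qed.

Context (z : n.-tuple (R * R)).

Definition no_ties : Prop :=
  injective (fun i => (tnth z i).1) /\ injective (fun i => (tnth z i).2).

(** Geometric counterpart of an increasing subsequence: on samples without ties, [xr] carries such
    sets of point labels to the index sets counted by [LIS], so later arguments speak of coordinates
    only. *)
Definition point_chain (K : {set 'I_n}) : bool :=
  [forall i in K, forall j in K,
    ((tnth z i).1 < (tnth z j).1) ==> ((tnth z i).2 < (tnth z j).2)].

Let xr := rank_ord (fun i => (tnth z i).1).
Let yr := rank_ord (fun i => (tnth z i).2).

Hypothesis nt : no_ties.

Lemma perm_of_pointsE (k : 'I_n) : perm_of_points z (xr k) = yr k.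
Proof.
have xinj : injective xr by apply: rank_ord_inj; case: nt.
have yinj : injective yr by apply: rank_ord_inj; case: nt.
suff /forallP/(_ k)/forallP/(_ (xr k))/implyP : is_perm_of_points z (perm_of_points z).
  by move=> /(_ (eqxx _)) /eqP sxy; apply: val_inj; exact: sxy.
(* The product acts from left to right: undo the x-rank, then take the y-rank. This witness shows
   that [pick] never falls back on the default permutation. *)
rewrite /perm_of_points; case: pickP => // /(_ ((perm xinj)^-1 * perm yinj)%g) /negbT/negP[].
apply/forallP => l; apply/forallP => i; apply/implyP => /eqP il.
have -> : i = xr l by apply: val_inj; exact: il.
by rewrite permM -[xr l](permE xinj) permK permE.
Qed.

Let xr_inj : injective xr. Proof. by apply: rank_ord_inj; case: nt. Qed.

Let chain_xr (K : {set 'I_n}) : point_chain K =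
  [forall i in xr @: K, forall j in xr @: K,
    (i < j)%N ==> (perm_of_points z i < perm_of_points z j)%N].
Proof.
apply/forall_inP/forall_inP => H.
  move=> _ /imsetP[i iK ->]; apply/forall_inP => _ /imsetP[j jK ->].
  rewrite !perm_of_pointsE /= !ltn_rank.
  by have /forall_inP := H _ iK; apply.
move=> i iK; apply/forall_inP => j jK.
have /forall_inP/(_ _ (imset_f xr jK)) := H _ (imset_f xr iK).
by rewrite !perm_of_pointsE /= !ltn_rank.
Qed.

Lemma point_chain_le_LIS (K : {set 'I_n}) :
  point_chain K -> (#|K| <= LIS (perm_of_points z))%N.
Proof.
rewrite chain_xr => H; rewrite -(card_imset _ xr_inj).
exact: (leq_bigmax_cond (xr @: K)%SET).
Qed.

Lemma LIS_point_chain : exists2 K, point_chain K & LIS (perm_of_points z) = #|K|.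
Proof.
have [|I HI E] := @eq_bigmax_cond _ [pred I : {set 'I_n} | [forall i in I, forall j in I,
    (i < j)%N ==> (perm_of_points z i < perm_of_points z j)%N]] (fun I => #|I|).
  (* The empty set is admissible, so the maximum defining [LIS] is attained. *)
  by apply/card_gt0P; exists finset.set0; apply/forall_inP => i; rewrite inE.
exists (xr @^-1: I)%SET.
  rewrite chain_xr; apply/forall_inP => _ /imsetP[i iK ->].
  apply/forall_inP => _ /imsetP[j jK ->].
  by move: iK jK HI; rewrite !inE => iI jI /forall_inP/(_ _ iI)/forall_inP/(_ _ jI).
have -> : LIS (perm_of_points z) = #|I| by exact: E.
rewrite on_card_preimset //; apply: onW_bij; exact: injF_bij.
Qed.

End LIS_of_points.

(** * Union bound, product laws and almost sure absence of ties *)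

Lemma measure_bigcup_pred_le d (T : measurableType d) (R : realType)
    (mu : {measure set T -> \bar R}) (I : finType) (P : {pred I}) (F : I -> set T) :
  (forall i, P i -> measurable (F i)) ->
  (mu (\bigcup_(i in [set` P]) F i) <= \sum_(i in P) mu (F i))%E.
Proof.
move=> mF; rewrite bigcup_pred.
(* Measurability of the partial unions travels with the bound, since subadditivity asks for it at
   each step. *)
suff [] : measurable (\big[setU/set0]_(i in P) F i) /\
    (mu (\big[setU/set0]_(i in P) F i) <= \sum_(i in P) mu (F i))%E by [].
elim/big_rec2 : _ => [|i y A Pi [mA leA]]; first by rewrite measure0.
split; first by apply: measurableU => //; exact: mF.
apply: le_trans (measureU2 _ (mF _ Pi) mA) _.
by rewrite leeD2l.
Qed.

Section iid_laws.
Context d (T : measurableType d) (R : realType) (mu : probability T R).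

Lemma iidS n (A : set (n.+1.-tuple T)) :
  iid mu n.+1 A = (mu \x iid mu n)%E (@tuple_cons _ T n @^-1` A).
Proof. by []. Qed.

Lemma measurable_box n (S : 'I_n -> set T) : (forall i, measurable (S i)) ->
  measurable [set w : n.-tuple T | forall i, S i (tnth w i)].
Proof.
move=> mS.
have -> : [set w : n.-tuple T | forall i, S i (tnth w i)] =
    \bigcap_(i in [set: 'I_n]) ((fun w => tnth w i) @^-1` S i).
  by apply/seteqP; split => w /= H i; [move=> _|]; exact: H.
apply: fin_bigcap_measurable => // i _; rewrite -[X in measurable X]setTI.
exact: measurable_tnth.
Qed.

Lemma iid_box n (S : 'I_n -> set T) : (forall i, measurable (S i)) ->
  iid mu n [set w | forall i, S i (tnth w i)] = (\prod_(i < n) mu (S i))%E.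
Proof.
elim: n S => [|n IH] S mS.
  rewrite big_ord0 /= diracE; apply/eqP; rewrite eqe pnatr_eq1 eqb1.
  by apply/mem_set => -[].
rewrite iidS big_ord_recl -IH //.
rewrite -product_measure1E //; last by apply: (@measurable_box n (fun i => S (lift ord0 i))).
congr (_ _); apply/seteqP; split => -[a w] /=.
  move=> H; split; first by have := H ord0; rewrite tnth0.
  by move=> i; have := H (lift ord0 i); rewrite tnthS.
move=> [Ha H] i; case: (unliftP ord0 i) => [j ->|->]; first by rewrite tnthS.
by rewrite tnth0.
Qed.

(** An unconstrained coordinate is a box side equal to [setT], which contributes a factor 1. *)
Lemma iid_coords n (P : {pred 'I_n}) (D : set T) : measurable D ->
  iid mu n [set w | forall i, P i -> D (tnth w i)] = (mu D ^+ #|P|)%E.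
Proof.
move=> mD.
have -> : [set w : n.-tuple T | forall i, P i -> D (tnth w i)] =
    [set w | forall i, (if P i then D else setT) (tnth w i)].
  apply/seteqP; split => w /= H i; first by case: ifPn => // Pi; exact: H.
  by have := H i; case: ifPn.
rewrite (@iid_box n (fun i => if P i then D else setT)); last by move=> i; case: ifP.
transitivity (\prod_(i in P) mu D)%E; last first.
  by rewrite big_const; elim: #|P| => [|k IHk]; rewrite ?expe0 // expeS -IHk.
rewrite [RHS]big_mkcond; apply: eq_bigr => i _.
by rewrite [in RHS]unfold_in; case: ifP => // _; rewrite probability_setT.
Qed.

Lemma iid_tnth n (D : set T) (i : 'I_n) : measurable D ->
  iid mu n [set w | D (tnth w i)] = mu D.
Proof.
move=> mD; have := iid_coords (pred1 i) mD; rewrite card1 expeS expe0 mule1 => <-.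
by congr (_ _); apply/seteqP; split => w /=; [move=> Dw j /eqP ->|apply; exact: eqxx].
Qed.

Variables (f : T -> R) (mf : measurable_fun setT f).

Lemma measurable_eq_fun d' (U : measurableType d') (g h : U -> R) :
  measurable_fun setT g -> measurable_fun setT h -> measurable [set x | g x = h x].
Proof.
move=> mg mh.
have := measurable_fun_eqr mg mh.
move=> /(_ measurableT [set true] I); rewrite setTI.
by congr (measurable _); apply/seteqP; split => x /=; move/eqP.
Qed.

Let mft n (i : 'I_n) : measurable_fun setT (fun w : n.-tuple T => f (tnth w i)).
Proof. by apply: measurableT_comp mf _; exact: measurable_tnth. Qed.

Lemma measurable_injective n :
  measurable [set w : n.-tuple T | injective (fun i => f (tnth w i))].
Proof.
have -> : [set w : n.-tuple T | injective (fun i => f (tnth w i))] =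
    \bigcap_(p in [set p : 'I_n * 'I_n | p.1 <> p.2])
      ~` [set w | f (tnth w p.1) = f (tnth w p.2)].
  apply/seteqP; split => w /=.
    by move=> H [i j] /= ij /H.
  move=> H i j fij; apply: contrapT => ij.
  exact: (H (i, j)).
apply: fin_bigcap_measurable => // p _; apply: measurableC.
by apply: measurable_eq_fun; exact: mft.
Qed.

Hypothesis f_null : forall r, mu (f @^-1` [set r]) = 0%E.

(** Induction on [n]: a tie occurs either within the tail or between the head and some tail
    coordinate [j]. The second event, [D j], is null by Fubini, because its section at a fixed head
    constrains one coordinate to a level set of [f]. *)
Lemma iid_injective n :
  iid mu n (~` [set w | injective (fun i => f (tnth w i))]) = 0%E.
Proof.
elim: n => [|n IH].
  rewrite (_ : ~` _ = set0) ?measure0 //.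
  by rewrite -subset0 => w; apply => -[].
pose D (j : 'I_n) := [set p : T * n.-tuple T | f (tnth p.2 j) = f p.1].
have mD j : measurable (D j).
  apply: measurable_eq_fun; last exact: measurableT_comp mf measurable_fst.
  exact: measurableT_comp (mft _) measurable_snd.
have D0 j : (mu \x iid mu n)%E (D j) = 0%E.
  apply: integral0_eq => a _ /=.
  rewrite (_ : xsection _ _ = [set w | (f @^-1` [set f a]) (tnth w j)]).
    by rewrite iid_tnth ?f_null // -[X in measurable X]setTI; exact: mf.
  by apply/seteqP; split => w; rewrite /xsection /= ?inE.
set N := ~` _ in IH; have mN : measurable N by apply: measurableC; exact: measurable_injective.
rewrite iidS; apply/eqP; rewrite -measure_le0.
pose B : set (T * n.-tuple T) := (\bigcup_(j in [set` @predT 'I_n]) D j) `|` (setT `*` N).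
apply: (@le_trans _ _ ((mu \x iid mu n)%E B)).
  apply: le_measure; rewrite ?inE.
  - rewrite -[X in measurable X]setTI; apply: measurable_tuple_cons => //.
    by apply: measurableC; exact: measurable_injective.
  - apply: measurableU; last exact: measurableX.
    by apply: fin_bigcup_measurable => [|j _]; [exact: finite_finset|exact: mD].
  move=> [a w] /= Hinj; apply: contrapT => H; apply: Hinj => i j.
  have Hw : injective (fun i => f (tnth w i)).
    by apply: contrapT => Hw; apply: H; right.
  have Ha k : f (tnth w k) <> f a by move=> E; apply: H; left; exists k.
  case: (unliftP ord0 i) => [i' ->|->]; case: (unliftP ord0 j) => [j' ->|->];
    rewrite ?tnthS ?tnth0 //.
  - by move=> /Hw ->.
  - by move=> /Ha.
  - by move=> /esym/Ha.
apply: le_trans (measureU2 _ _ _) _.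
- by apply: fin_bigcup_measurable => [|j _]; [exact: finite_finset|exact: mD].
- exact: measurableX.
rewrite [X in (_ + X)%E](_ : _ = 0%E) ?adde0; last first.
  apply: etrans (product_measure1E mu (iid mu n) (@measurableT _ T) mN) _.
  exact: etrans (congr1 (mule (mu setT)) IH) (mule0 _).
apply: le_trans (measure_bigcup_pred_le _ (fun j _ => mD j)) _.
by rewrite big1 // => j _; exact: D0.
Qed.

End iid_laws.

(** * Lebesgue measure on the line: translation, splitting, uniform law *)

Section lebesgue_facts.
Context (R : realType).
Implicit Types (A B : set R) (a b c : R).
Local Notation leb := (@lebesgue_measure R).

Definition translation c (x : measurableTypeR R) : measurableTypeR R := x + c.

Lemma measurable_translation c : measurable_fun setT (translation c).
Proof. exact: measurable_funD. Qed.

HB.instance Definition _ c :=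
  isMeasurableFun.Build _ _ _ _ (translation c) (measurable_translation c).

(** The pushforward by a translation agrees with Lebesgue measure on half-open intervals, so
    uniqueness identifies the two. *)
Lemma lebesgue_measure_shift c A : measurable A ->
  leb ((fun x => x + c) @^-1` A) = leb A.
Proof.
move=> mA; have trE a b : leb `]a, b] = pushforward leb (translation c) `]a, b].
  have -> : pushforward leb (translation c) `]a, b] = leb `]a - c, b - c].
    rewrite /pushforward; congr (leb _).
    by apply/seteqP; split => x; rewrite /preimage /= !in_itv /= ltrBlDr lerBrDr.
  rewrite !lebesgue_measure_itv /= !lte_fin ltrD2r; case: ifP => // _.
  by rewrite -!EFinB opprD addrACA subrr addr0.
apply/esym/(@lebesgue_measure_unique R (pushforward leb (translation c))) => // _ [[a b]] _ <-.
exact: trE.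
Qed.

Lemma lebesgue_itvco a b : a <= b -> leb `[a, b[ = (b - a)%:E.
Proof.
move=> ab; rewrite lebesgue_measure_itv /= lte_fin.
by case: ltgtP ab => // ->; rewrite subrr.
Qed.

Lemma lebesgue_split a b c A : a <= b -> b <= c -> measurable A ->
  leb (A `&` `[a, c[) = (leb (A `&` `[a, b[) + leb (A `&` `[b, c[))%E.
Proof.
move=> ab bc mA; rewrite -measureU.
- rewrite -setIUr; congr (leb (A `&` _)); apply/seteqP; split => x /=.
    rewrite !in_itv /= => /andP[ax xc].
    by case: (ltP x b) => xb; [left|right]; rewrite ?ax ?xb.
  rewrite !in_itv /= => -[] /andP[h1 h2]; apply/andP; split => //.
    exact: lt_le_trans bc.
  exact: le_trans h1.
- exact: measurableI.
- exact: measurableI.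
- apply/seteqP; split => x //= -[[_]]; rewrite !in_itv /= => /andP[_ xb] [_ /andP[bx _]].
  by move: (lt_le_trans xb bx); rewrite ltxx.
Qed.

(** The endpoint 1 is dropped as a null set, so that the half-open blocks of the exchange partition
    the support exactly. *)
Lemma uniform_probE A : measurable A ->
  uniform_prob (@ltr01 R) A = leb (A `&` `[0, 1[).
Proof.
move=> mA; rewrite /uniform_prob integral_uniform_pdf.
rewrite (eq_integral (cst 1%E)); last first.
  move=> x; rewrite inE /= in_itv /= => -[_ x01].
  by rewrite /uniform_pdf x01 subr0 invr1.
rewrite integral_cst ?mul1e; last exact: measurableI.
have -> : A `&` `[0, 1] = (A `&` `[0, 1[) `|` (A `&` [set 1]).
  rewrite -setIUr; congr (_ `&` _); apply/seteqP; split => x /=; rewrite !in_itv /=.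
    move=> /andP[x0]; rewrite le_eqVlt => /orP[/eqP|x1]; [by right|by left; rewrite x0].
  by move=> [/andP[-> /ltW]//|->]; rewrite ler01 lexx.
rewrite measureU.
- rewrite [X in (_ + X)%E](_ : _ = 0%E) ?adde0 //.
  apply/eqP; rewrite -measure_le0 -(lebesgue_measure_set1 1).
  by apply: le_measure; rewrite ?inE //; exact: measurableI.
- exact: measurableI.
- exact: measurableI.
- apply/seteqP; split => x //= -[[_]]; rewrite in_itv /= => /andP[_ x1] [_ E].
  by rewrite E ltxx in x1.
Qed.

End lebesgue_facts.

(** * The interval exchange and its permuton *)

Section swap_permuton.
Context (R : realType) (s m : R).
Local Notation leb := (@lebesgue_measure R).

Definition swap_fun (x : R) : R :=
  if x < s then x else if x < m then x + (1 - m) else x + (s - m).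

Lemma measurable_swap_fun : measurable_fun setT swap_fun.
Proof.
apply: measurable_fun_ifT => //; first exact: measurable_fun_ltr.
by apply: measurable_fun_ifT; [exact: measurable_fun_ltr|exact: measurable_funD..].
Qed.

Definition swap_graph (x : measurableTypeR R) : R * R := (x, swap_fun x).

Lemma measurable_swap_graph : measurable_fun setT swap_graph.
Proof. by apply: measurable_fun_pair => //; exact: measurable_swap_fun. Qed.

HB.instance Definition _ := isMeasurableFun.Build _ _ _ _ swap_graph measurable_swap_graph.

Definition swap_permuton : probability (R * R)%type R :=
  distribution (uniform_prob (@ltr01 R)) swap_graph.

Lemma swap_permutonE (A : set (R * R)) : measurable A ->
  swap_permuton A = leb (swap_graph @^-1` A `&` `[0, 1[).
Proof.
move=> mA; rewrite -uniform_probE // -[X in measurable X]setTI.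
exact: measurable_swap_graph.
Qed.

Lemma swap_permuton_fst (B : set R) : measurable B ->
  swap_permuton (fst @^-1` B) = leb (B `&` `[0, 1[).
Proof.
move=> mB; rewrite swap_permutonE // -[X in measurable X]setTI.
exact: measurable_fst.
Qed.

Hypotheses (s_ge0 : 0 <= s) (le_sm : s <= m) (m_le1 : m <= 1).

(** The domain is cut at [s] and [m], the range at [s] and [s + (1 - m)]; the map is a translation
    from each piece of the domain onto a piece of the range. *)
Lemma swap_fun_preserves (B : set R) : measurable B ->
  leb (swap_fun @^-1` B `&` `[0, 1[) = leb (B `&` `[0, 1[).
Proof.
move: (s_ge0) (le_sm) (m_le1) => s0 sm m1 mB.
have mfB : measurable (swap_fun @^-1` B).
  by rewrite -[X in measurable X]setTI; exact: measurable_swap_fun.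
have ms1 : s <= s + (1 - m) by lra.
have s1m : s + (1 - m) <= 1 by lra.
rewrite (@lebesgue_split _ 0 s 1) ?(le_trans le_sm) // (@lebesgue_split _ s m 1) //.
rewrite (@lebesgue_split _ 0 s 1 B) ?(le_trans le_sm) //.
rewrite (@lebesgue_split _ s (s + (1 - m)) 1 B) //.
congr (_ + _)%E.
  congr (leb _); apply/seteqP; split => x /= [];
    by rewrite in_itv /= => + /andP[x0 xs]; rewrite /swap_fun xs x0.
(* The two upper pieces appear in opposite orders in the domain and in the range. *)
rewrite addeC; congr (_ + _)%E.
  rewrite -[RHS](lebesgue_measure_shift (s - m)); last exact: measurableI.
  congr (leb _); apply/seteqP; split => x /=; rewrite !in_itv /= => -[Bx /andP[h1 h2]].
    have xs : (x < s) = false by apply/negbTE; rewrite -leNgt; lra.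
    have xm : (x < m) = false by apply/negbTE; rewrite -leNgt; lra.
    by move: Bx; rewrite /swap_fun xs xm; split => //; apply/andP; split; lra.
  have xs : (x < s) = false by apply/negbTE; rewrite -leNgt; lra.
  have xm : (x < m) = false by apply/negbTE; rewrite -leNgt; lra.
  by rewrite /swap_fun xs xm; split => //; apply/andP; split; lra.
rewrite -[RHS](lebesgue_measure_shift (1 - m)); last exact: measurableI.
congr (leb _); apply/seteqP; split => x /=; rewrite !in_itv /= => -[Bx /andP[h1 h2]].
  have xs : (x < s) = false by apply/negbTE; rewrite -leNgt; lra.
  by move: Bx; rewrite /swap_fun xs h2; split => //; apply/andP; split; lra.
have xs : (x < s) = false by apply/negbTE; rewrite -leNgt; lra.
have xm : x < m by lra.
by rewrite /swap_fun xs xm; split => //; apply/andP; split; lra.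
Qed.

Lemma swap_permuton_snd (B : set R) : measurable B ->
  swap_permuton (snd @^-1` B) = leb (B `&` `[0, 1[).
Proof.
move=> mB; rewrite swap_permutonE; last first.
  by rewrite -[X in measurable X]setTI; exact: measurable_snd.
exact: swap_fun_preserves.
Qed.

Lemma swap_fun_itv (x : R) : 0 <= x <= 1 -> 0 <= swap_fun x <= 1.
Proof.
move: (s_ge0) (le_sm) (m_le1) => s0 sm m1 /andP[x0 x1]; rewrite /swap_fun.
by case: ltP => h1; [|case: ltP => h2]; apply/andP; split; lra.
Qed.

Lemma swap_permuton_is_permuton : is_permuton swap_permuton.
Proof.
split.
- rewrite swap_permutonE; last exact: measurableX.
  rewrite (_ : _ `&` _ = `[0, 1[%classic); first by rewrite lebesgue_itvco // subr0.
  apply/seteqP; split => x /=; first by case.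
  rewrite !in_itv /= => /andP[x0 x1]; have x01 : 0 <= x <= 1 by rewrite x0 ltW.
  by split; [split; rewrite /= in_itv //=; exact: swap_fun_itv|rewrite x0].
- by move=> B mB; rewrite uniform_probE // -swap_permuton_fst.
- by move=> B mB; rewrite uniform_probE // -swap_permuton_snd.
Qed.

End swap_permuton.

(** * Closed plane sets belong to the product sigma-algebra *)

Lemma open_measurable_prod (R : realType) (O : set (R * R)) : open O -> measurable O.
Proof.
move=> oO.
pose box (p : rat * rat * rat) : set (R * R) :=
  ball (ratr p.1.1 : R) (ratr p.2) `*` ball (ratr p.1.2 : R) (ratr p.2).
have -> : O = \bigcup_(p in [set p | box p `<=` O]) box p.
  apply/seteqP; split => [[x y] Oxy|q [p /= pO /pO]//].
  have /nbhs_ballP[e /= e0 eO] : nbhs (x, y) O by exact: open_nbhs_nbhs.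
  (* With centre within [r] of the point in each coordinate, the box of radius [r] contains the
     point and stays within [2 * r < e] of it. There are only countably many such rational boxes. *)
  have /rat_in_itvoo[r /[!in_itv]/= /andP[r0 re]] : 0 < e / 2 by exact: divr_gt0.
  have near_rat (u : R) : exists a : rat, `|u - ratr a| < ratr r.
    have /rat_in_itvoo[a /[!in_itv]/= /andP[ra ar]] : u - ratr r < u + ratr r by lra.
    by exists a; rewrite ltr_norml; apply/andP; split; lra.
  have [[a xa] [b yb]] := (near_rat x, near_rat y).
  exists (a, b, r); last by split; rewrite /= /ball /= distrC.
  move=> [u v] [/= ua vb]; apply: eO; split => /=.
    rewrite /ball /= in ua *; rewrite -(subrKA (ratr a)).
    by apply: le_lt_trans (ler_normD _ _) _; lra.
  rewrite /ball /= in vb *; rewrite -(subrKA (ratr b)).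
  by apply: le_lt_trans (ler_normD _ _) _; lra.
rewrite bigcup_mkcond; apply: countable_bigcupT_measurable => // p.
by case: ifP => // _; apply: measurableX; exact: measurable_ball.
Qed.

Lemma closed_measurable_prod (R : realType) (A : set (R * R)) : closed A -> measurable A.
Proof.
move=> cA; rewrite -[A]setCK; apply: measurableC; apply: open_measurable_prod.
exact: closed_openC.
Qed.

(** * The shape of the exchange permutons *)

Section swap_permuton_shape.
Context (R : realType) (s m : R).
Local Notation leb := (@lebesgue_measure R).

Lemma swap_fun_lt (x y : R) : (x < s) = (y < s) -> (x < m) = (y < m) ->
  x < y -> swap_fun s m x < swap_fun s m y.
Proof. by rewrite /swap_fun => -> ->; case: ifP; [|case: ifP]; rewrite ?ltrD2r. Qed.

(** The exchange is strictly increasing on each block, so a nonincreasing piece meets the graph over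
    a block in at most one point. The two booleans in the index of [F] label the block. *)
Lemma nonincreasing_graph_countable (k : nat) (A : set (R * R)) :
  k_nonincreasing k A -> countable (@swap_graph R s m @^-1` A).
Proof.
move=> [B incB AB].
pose F (p : 'I_k * (bool * bool)) : set R :=
  [set x | [/\ B p.1 (swap_graph s m x), (x < s) = p.2.1 & (x < m) = p.2.2]].
apply: (@sub_countable _ _ _ (\bigcup_(p in setT) F p)).
  apply: subset_card_le => x; rewrite /preimage /= AB => -[i _ Bix].
  by exists (i, (x < s, x < m)).
apply: bigcup_countable => // p _.
have F1 x y : F p x -> F p y -> ~ x < y.
  move=> [Bx xs xm] [By ys ym] xy.
  have := incB _ _ _ Bx By; rewrite leNgt => /negP; apply.
  rewrite mulr_gt0 ?subr_gt0 //.
  by apply: swap_fun_lt => //; rewrite ?xs ?ys ?xm ?ym.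
have [->|/set0P[a Fa]] := eqVneq (F p) set0; first exact: countable0.
rewrite (_ : F p = [set a]); first exact: countable1.
apply/seteqP; split => [x Fx|x ->//] /=.
by case: (ltgtP x a) => // h; [case: (F1 _ _ Fx Fa h)|case: (F1 _ _ Fa Fx h)].
Qed.

Lemma LDSt_swap_permuton (k : nat) : LDSt (swap_permuton s m) k = 0%E.
Proof.
case: k => // k; rewrite /LDSt.
rewrite (_ : [set _ | _ in _] = [set 0%E]) ?ereal_sup1 //.
apply/seteqP; split => [_ [A [cA _ kA] <-]|_ ->].
  rewrite swap_permutonE; last exact: closed_measurable_prod.
  apply: countable_lebesgue_measure0.
  apply: sub_countable (nonincreasing_graph_countable kA).
  by apply: subset_card_le; exact: subIsetl.
(* The empty set shows that the value 0 is attained, so the supremum is not over an empty family. *)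
exists set0; last by rewrite measure0.
split=> //; first exact: closed0.
by exists (fun=> set0) => [i p q []|]; apply/seteqP; split => // q [].
Qed.

(** The pieces of the graph are taken with both endpoints because [LISt] ranges over closed sets. *)
Definition segment (a b c : R) : set (R * R) :=
  [set q | [/\ a <= q.1, q.1 <= b & q.2 = q.1 + c]].

Lemma closed_segment a b c : closed (segment a b c).
Proof.
have -> : segment a b c = fst @^-1` `[a, b]%classic `&` (fun q : R * R => q.2 - q.1) @^-1` [set c].
  apply/seteqP; split => -[x y]; rewrite /segment /preimage /= in_itv /=.
    by move=> [-> -> ->]; split => //; lra.
  by move=> [/andP[-> ->]] <-; split => //; lra.
apply: closedI.
  apply: preimage_closed; last exact: interval_closed.
  by move=> x _; exact: cvg_fst.
apply: preimage_closed; last exact: closed_eq.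
by move=> x _; apply: cvgB; [exact: cvg_snd|exact: cvg_fst].
Qed.

Lemma nondecreasing_segment a b c : nondecreasing_set (segment a b c).
Proof.
move=> [x x'] [y y'] [/= _ _ ->] [/= _ _ ->].
rewrite opprD addrACA subrr addr0 -expr2; exact: sqr_ge0.
Qed.

Hypotheses (s_ge0 : 0 <= s) (le_sm : s <= m) (m_le1 : m <= 1).
Hypothesis long_m : s + (1 - m) <= m.

(** The graph over [[m, 1)] lies to the lower right of the graph over [[s, m)], so a nondecreasing
    set cannot meet both. It catches mass at most [m] in one case, and at most [s + (1 - m)] in the
    other, where [long_m] concludes. *)
Lemma nondecreasing_swap_permuton (A : set (R * R)) :
  closed A -> nondecreasing_set A -> (swap_permuton s m A <= m%:E)%E.
Proof.
move: (s_ge0) (le_sm) (m_le1) (long_m) => s0 sm m1 lm cA ndA.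
have mA : measurable A by exact: closed_measurable_prod.
have mfA : measurable (swap_graph s m @^-1` A).
  by rewrite -[X in measurable X]setTI; exact: measurable_swap_graph.
rewrite swap_permutonE //.
have [[x [x1 x2 Ax]]|nB] := pselect (exists x, [/\ s <= x, x < m & A (swap_graph s m x)]).
  rewrite -[m in X in (_ <= X)%E]subr0 -lebesgue_itvco; last exact: le_trans le_sm.
  apply: le_measure; rewrite ?inE //; first exact: measurableI.
  move=> y /= [Ay]; rewrite !in_itv /= => /andP[-> y1] /=; rewrite ltNge; apply/negP => my.
  have := ndA _ _ Ax Ay; rewrite /swap_graph /swap_fun /= x2.
  have -> : (x < s) = false by apply/negbTE; rewrite -leNgt.
  have -> : (y < s) = false by apply/negbTE; rewrite -leNgt; lra.
  have -> : (y < m) = false by apply/negbTE; rewrite -leNgt.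
  rewrite leNgt => /negP; apply; rewrite nmulr_llt0; lra.
apply: (@le_trans _ _ (leb (`[0, s[ `|` `[m, 1[))).
  apply: le_measure; rewrite ?inE //; [exact: measurableI|exact: measurableU|].
  move=> y /= [Ay]; rewrite !in_itv /= => /andP[y0 y1].
  case: (ltP y s) => ys; first by left; rewrite y0.
  case: (ltP y m) => ym; first by case: nB; exists y.
  by right; rewrite y1.
apply: le_trans (measureU2 _ _ _) _ => //.
rewrite [X in (X + _ <= _)%E](lebesgue_itvco s_ge0) [X in (_ + X <= _)%E](lebesgue_itvco m_le1).
by rewrite -EFinD lee_fin subr0.
Qed.

(** The optimal nondecreasing set: the fixed block followed by the block shifted upwards, of total
    mass [m]. *)
Let diag := segment 0 s 0 `|` segment s m (1 - m).

Let nondecreasing_diag : nondecreasing_set diag.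
Proof.
move: (s_ge0) (le_sm) (m_le1) => s0 sm m1.
move=> p q [Hp|Hp] [Hq|Hq]; try exact: (nondecreasing_segment Hp Hq).
- move: Hp Hq; case: p => ? ?; case: q => ? ? /= [/= ? ? ->] [/= ? ? ->].
  by apply: mulr_ge0; lra.
- move: Hp Hq; case: p => ? ?; case: q => ? ? /= [/= ? ? ->] [/= ? ? ->].
  by apply: mulr_le0; lra.
Qed.

Let diag_sub : diag `<=` @unit_square R.
Proof.
move: (s_ge0) (le_sm) (m_le1) => s0 sm m1.
by move=> [x y] [] [/= ? ? ->]; split => /=; rewrite in_itv /=; apply/andP; split; lra.
Qed.

Lemma LIS1_swap_permuton : LISt (swap_permuton s m) 1 = m%:E.
Proof.
move: (s_ge0) (le_sm) (m_le1) => s0 sm m1.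
apply/eqP; rewrite eq_le; apply/andP; split.
  apply: ge_ereal_sup => _ [A [cA _ [B ndB AB]] <-].
  apply: nondecreasing_swap_permuton => //.
  by rewrite AB => p q [i _ Bp] [j _ Bq]; apply: (ndB i) => //; rewrite (ord1 i) -(ord1 j).
apply: (@le_trans _ _ (swap_permuton s m diag)); last first.
  apply: ereal_sup_ubound; exists diag => //; split => //.
    by apply: closedU; exact: closed_segment.
  by exists (fun=> diag) => //; rewrite bigcup_const //; exists ord0.
have mdiag : measurable diag by apply: closed_measurable_prod; apply: closedU; exact: closed_segment.
rewrite swap_permutonE // -[m in X in (X <= _)%E]subr0 -lebesgue_itvco; last exact: le_trans le_sm.
apply: le_measure; rewrite ?inE //.
  apply: measurableI => //; rewrite -[X in measurable X]setTI; exact: measurable_swap_graph.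
move=> x /=; rewrite !in_itv /= => /andP[x0 xm]; rewrite x0 (lt_le_trans xm) //; split => //.
rewrite /diag /segment /swap_graph /swap_fun /= xm; case: ltP => xs.
  by left; rewrite addr0; split => //; exact: ltW.
by right; split => //; exact: ltW.
Qed.

Lemma LIS2_swap_permuton (k : nat) : LISt (swap_permuton s m) k.+2 = 1%E.
Proof.
move: (s_ge0) (le_sm) (m_le1) => s0 sm m1.
apply/eqP; rewrite eq_le; apply/andP; split.
  apply: ge_ereal_sup => _ [A [cA _ _] <-].
  by apply: probability_le1; exact: closed_measurable_prod.
pose A := diag `|` segment m 1 (s - m).
have cA : closed A by do !apply: closedU; exact: closed_segment.
apply: (@le_trans _ _ (swap_permuton s m A)); last first.
  apply: ereal_sup_ubound; exists A => //; split => //.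
    move=> q [/diag_sub//|]; case: q => x y [/= ? ? ->].
    by split => /=; rewrite in_itv /=; apply/andP; split; lra.
  (* Two pieces already cover the graph; all indices other than 0 repeat the last segment. *)
  exists (fun i : 'I_k.+2 => if i == ord0 then diag else segment m 1 (s - m)).
    by move=> i; case: ifP => // _; exact: nondecreasing_segment.
  apply/seteqP; split => [q [H|H]|q [i _]].
  - by exists ord0.
  - by exists ord_max.
  - by case: ifP => _ H; [left|right].
rewrite swap_permutonE; last exact: closed_measurable_prod.
rewrite -[1%E]/((1%R)%:E) -[1%R in X in (X <= _)%E]subr0 -lebesgue_itvco //.
apply: le_measure; rewrite ?inE //.
  apply: measurableI => //; rewrite -[X in measurable X]setTI.
  by apply: measurable_swap_graph => //; exact: closed_measurable_prod.
move=> x /=; rewrite in_itv /= => /andP[x0 x1]; rewrite x0 x1; split => //.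
rewrite /A /diag /segment /swap_graph /swap_fun /=; case: ltP => xs.
  by left; left; rewrite addr0; split => //; exact: ltW.
case: ltP => xm; first by left; right; split => //; exact: ltW.
by right; split => //; exact: ltW.
Qed.

(** The right-hand side is free of [s]: this is what lets two different exchanges share a shape. *)
Lemma sht_swap_permuton :
  sht (swap_permuton s m) =
  (fun k => if k is k'.+1 then if k' is 0 then (1 - m%:E)%E else 0%E else m%:E, fun=> 0%E).
Proof.
congr pair; apply/funext => k; last by rewrite !LDSt_swap_permuton sube0.
case: k => [|[|k]]; first by rewrite LIS1_swap_permuton sube0.
  by rewrite LIS2_swap_permuton LIS1_swap_permuton.
by rewrite !LIS2_swap_permuton subee.
Qed.

End swap_permuton_shape.

(** * Almost sure properties of samples *)

Section swap_permuton_samples.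
Context (R : realType) (s m : R).
Local Notation leb := (@lebesgue_measure R).
Local Notation mu := (swap_permuton s m).
Hypotheses (s_ge0 : 0 <= s) (le_sm : s <= m) (m_le1 : m <= 1).

Definition on_swap_graph (q : R * R) : Prop :=
  [/\ 0 <= q.1, q.1 < 1 & q.2 = swap_fun s m q.1].

(** The almost sure event on which statements about [LIS] become deterministic. *)
Definition generic n : set (n.-tuple (R * R)) :=
  [set z | no_ties z /\ forall i, on_swap_graph (tnth z i)].

Let measurable_on_swap_graph : measurable on_swap_graph.
Proof.
rewrite (_ : on_swap_graph = (fst @^-1` `[0, 1[) `&` [set q : R * R | q.2 = swap_fun s m q.1]).
  apply: measurableI.
    by rewrite -[X in measurable X]setTI; exact: measurable_fst.
  apply: measurable_eq_fun => //; apply: measurableT_comp measurable_fst.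
  exact: measurable_swap_fun.
apply/seteqP; split => q; rewrite /preimage /= in_itv /=.
  by move=> [-> -> ->].
by move=> [/andP[]].
Qed.

Lemma measurable_generic n : measurable (@generic n).
Proof.
rewrite (_ : @generic n = ([set z : n.-tuple (R * R) | injective (fun i => (tnth z i).1)] `&`
    [set z : n.-tuple (R * R) | injective (fun i => (tnth z i).2)]) `&`
    [set z : n.-tuple (R * R) | forall i, on_swap_graph (tnth z i)]) //.
apply: measurableI; last exact: (@measurable_box _ _ n (fun=> on_swap_graph)).
by apply: measurableI; apply: measurable_injective.
Qed.

(** Both marginals are atomless, which excludes ties, and each point lies on the graph with
    probability 1. *)
Lemma iid_generic n : iid mu n (~` @generic n) = 0%E.
Proof.
have leb1 (r : R) : leb ([set r] `&` `[0, 1[) = 0%E.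
  apply/eqP; rewrite -measure_le0 -(lebesgue_measure_set1 r).
  by apply: le_measure; rewrite ?inE //; exact: measurableI.
pose X1 := [set z : n.-tuple (R * R) | injective (fun i => (tnth z i).1)].
pose X2 := [set z : n.-tuple (R * R) | injective (fun i => (tnth z i).2)].
pose X3 := [set z : n.-tuple (R * R) | forall i, on_swap_graph (tnth z i)].
have mX1 : measurable X1 by apply: measurable_injective.
have mX2 : measurable X2 by apply: measurable_injective.
have mX3 : measurable X3 by exact: (@measurable_box _ _ n (fun=> on_swap_graph)).
have X10 : iid mu n (~` X1) = 0%E.
  apply: iid_injective => // r; rewrite swap_permuton_fst //; exact: leb1.
have X20 : iid mu n (~` X2) = 0%E.
  apply: iid_injective => // r; rewrite swap_permuton_snd //; exact: leb1.
have X30 : iid mu n (~` X3) = 0%E.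
  rewrite probability_setC // (@iid_box _ _ _ _ n (fun=> on_swap_graph)) //.
  rewrite big1 ?subee // => i _; rewrite swap_permutonE //.
  rewrite (_ : _ `&` _ = `[0, 1[%classic); first by rewrite lebesgue_itvco // subr0.
  apply/seteqP; split => x /=; first by case.
  by rewrite in_itv /= => /andP[x0 x1]; split; [split|rewrite x0 x1].
apply/eqP; rewrite -measure_le0.
apply: (@le_trans _ _ (iid mu n ((~` X1 `|` ~` X2) `|` ~` X3))).
  apply: le_measure; rewrite ?inE.
  - by apply: measurableC; exact: measurable_generic.
  - by apply: measurableU; [apply: measurableU|]; exact: measurableC.
  - rewrite -!setCI => z; apply: contra_not => -[[? ?] ?]; split=> //; by split.
apply: le_trans (measureU2 _ _ _) _.
- by apply: measurableU; exact: measurableC.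
- exact: measurableC.
rewrite [X in (_ + X <= _)%E]X30 adde0.
apply: le_trans (measureU2 _ _ _) _; [exact: measurableC..|].
by rewrite [X in (_ + X <= _)%E]X20 [X in (X + _ <= _)%E]X10 adde0.
Qed.

(** Lets inclusions between events be checked on generic samples only. *)
Lemma le_iid_generic n (A B : set (n.-tuple (R * R))) :
  measurable A -> measurable B -> A `&` @generic n `<=` B ->
  (iid mu n A <= iid mu n B)%E.
Proof.
move=> mA mB AB; apply: (@le_trans _ _ (iid mu n (B `|` ~` @generic n))).
  apply: le_measure; rewrite ?inE //.
    by apply: measurableU => //; apply: measurableC; exact: measurable_generic.
  move=> z Az; have [gz|gz] := pselect (generic z); last by right.
  by left; exact: AB.
apply: le_trans (measureU2 _ _ _) _ => //.
  by apply: measurableC; exact: measurable_generic.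
by rewrite [X in (_ + X <= _)%E]iid_generic adde0.
Qed.

Lemma measurable_LIS_event n (E : set 'S_n) : measurable (@perm_of_points R n @^-1` E).
Proof.
by rewrite -[X in measurable X]setTI; exact: measurable_perm_of_points.
Qed.

End swap_permuton_samples.

Lemma small_LISE (R : realType) (l n : nat) :
  (l%:R < 2 / 3 * n%:R :> R) = (3 * l < 2 * n)%N.
Proof.
rewrite -(ltr_nat R) !natrM.
by apply/idP/idP; lra.
Qed.

(** * Lower bound on the tail when [s = 0] *)

Section lower_bound.
Context (R : realType) (m : R) (n : nat).
Hypotheses (m_gt0 : 0 < m) (m_lt1 : m < 1).
Local Notation mu := (swap_permuton 0 m).

Let pattern (z : n.-tuple (R * R)) : Prop := forall i : 'I_n, odd i = (m <= (tnth z i).1).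

(** Halving is injective on the indices of one parity and takes values at most [n./2]. *)
Let card_parity (b : bool) : (#|[set i : 'I_n | odd i == b]%SET| <= n./2.+1)%N.
Proof.
rewrite -[X in (_ <= X)%N]card_ord -(@card_in_imset _ _ (fun i : 'I_n => inord i./2 : 'I_(n./2.+1))).
  exact: max_card.
move=> i j; rewrite !inE => /eqP oi /eqP oj /(congr1 val) /=.
have half_lt (k : 'I_n) : (k./2 < n./2.+1)%N.
  by rewrite ltnS; apply: half_leq; exact: ltnW.
rewrite !inordK // => hij; apply: val_inj => /=.
by rewrite -(odd_double_half i) -(odd_double_half j) oi oj hij.
Qed.

Lemma pattern_LIS (z : n.-tuple (R * R)) : generic 0 m z -> pattern z ->
  (LIS (perm_of_points z) <= n./2.+1)%N.
Proof.
move: (m_gt0) (m_lt1) => m0 m1 [nt Gz] pz.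
have [K /forall_inP chK ->] := LIS_point_chain nt.
(* Points of index even lie above and to the left of points of odd index. *)
have noboth (i j : 'I_n) : i \in K -> j \in K -> ~~ odd i -> odd j -> False.
  move=> iK jK oi oj.
  have /forall_inP/(_ _ jK)/implyP := chK _ iK.
  have [xi0 xi1 ->] := Gz i; have [xj0 xj1 ->] := Gz j.
  move: oi oj; rewrite !pz -ltNge => xim mxj.
  have -> : swap_fun 0 m (tnth z i).1 = (tnth z i).1 + (1 - m).
    by rewrite /swap_fun ltNge xi0 xim.
  have -> : swap_fun 0 m (tnth z j).1 = (tnth z j).1 + (0 - m).
    by rewrite /swap_fun !ltNge xj0 mxj.
  by move=> /(_ (lt_le_trans xim mxj)); lra.
have [[i /andP[iK oi]]|nodd] := pselect (exists i : 'I_n, (i \in K) && odd i).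
  apply: leq_trans (card_parity true); apply: subset_leq_card.
  apply/fintype.subsetP => j jK; rewrite inE; apply/eqP; apply: contrapT => /negP oj.
  exact: (noboth j i).
apply: leq_trans (card_parity false); apply: subset_leq_card.
apply/fintype.subsetP => j jK; rewrite inE; apply/eqP/negP => oj.
by apply: nodd; exists j; rewrite jK.
Qed.

(** The product is the exact probability of the alternating pattern. The condition on [n] makes
    [n./2.+1] smaller than [2n/3]; equality holds at [n = 6]. *)
Lemma lower_tail_ge : (6 < n)%N ->
  (\prod_(i < n) (if odd i then (1 - m)%:E else m%:E) <=
   Sample n mu [set t : 'S_n | ((LIS t)%:R < 2 / 3 * n%:R :> R)%R])%E.
Proof.
move: (m_gt0) (m_lt1) => m0 m1 n6.
pose S (i : 'I_n) : set (R * R) := fst @^-1` (if odd i then `[m, +oo[ else `]-oo, m[)%classic.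
have mS i : measurable (S i).
  by rewrite /S -[X in measurable X]setTI; apply: measurable_fst => //; case: ifP.
have -> : (\prod_(i < n) (if odd i then (1 - m)%:E else m%:E))%E =
    iid mu n [set w | forall i, S i (tnth w i)].
  rewrite iid_box //; apply: eq_bigr => i _; rewrite swap_permuton_fst; last by case: ifP.
  case: ifP => _.
    rewrite (_ : _ `&` _ = `[m, 1[%classic); first by rewrite lebesgue_itvco // ltW.
    apply/seteqP; split => x /=; rewrite !in_itv /= ?andbT.
      by move=> [-> /andP[]].
    by move=> /andP[mx ->]; rewrite mx (le_trans (ltW m0)).
  rewrite (_ : _ `&` _ = `[0, m[%classic); first by rewrite lebesgue_itvco ?subr0 // ltW.
  apply/seteqP; split => x /=; rewrite !in_itv /= ?andbT.
    by move=> [-> /andP[->]].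
  by move=> /andP[-> mx]; rewrite mx (lt_trans mx).
apply: (@le_iid_generic R 0 m _ _ _ n) => //; rewrite ?ltW //.
- exact: measurable_box.
- exact: measurable_LIS_event.
move=> z [Sz gz] /=; rewrite small_LISE.
have := @pattern_LIS z gz; have : pattern z.
  move=> i; have := Sz i; rewrite /S /preimage /=; case: ifP => _ /=; rewrite in_itv /= ?andbT //.
  by rewrite leNgt => ->.
move=> pz /(_ pz); have := odd_double_half n; lia.
Qed.

End lower_bound.

(** * Upper bound on the tail for general [s] *)

Section upper_bound.
Context (R : realType) (s m : R) (n : nat).
Hypotheses (s_ge0 : 0 <= s) (le_sm : s <= m) (m_le1 : m <= 1).
Local Notation mu := (swap_permuton s m).

(** With [A], [B], [C] the labels of the points in the three blocks, [A :|: B] and [A :|: C] are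
    chains. Adding their bounds gives [2|A| + |B| + |C| <= 2 LIS], where [|A| + |B| + |C| = n]. *)
Lemma generic_LIS (z : n.-tuple (R * R)) : generic s m z ->
  (2 * n <= 2 * LIS (perm_of_points z) + #|[set i : 'I_n | (s <= (tnth z i).1)%R]%SET|)%N.
Proof.
move: (s_ge0) (le_sm) (m_le1) => s0 sm m1 [nt Gz].
pose A := [set i : 'I_n | (tnth z i).1 < s]%SET.
pose B := [set i : 'I_n | s <= (tnth z i).1 < m]%SET.
pose C := [set i : 'I_n | m <= (tnth z i).1]%SET.
(* The first block lies below and to the left of the other two. *)
have cAB : point_chain z (A :|: B).
  apply/forall_inP => i iAB; apply/forall_inP => j jAB; apply/implyP.
  have [_ _ ->] := Gz i; have [_ _ ->] := Gz j.
  move: iAB jAB; rewrite !inE /swap_fun.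
  move: (tnth z i).1 (tnth z j).1 => x y.
  by case: (ltP x s) => xs; case: (ltP y s) => ys //=; case: (ltP x m) => xm //=;
    case: (ltP y m) => ym //= _ _; lra.
have cAC : point_chain z (A :|: C).
  apply/forall_inP => i iAB; apply/forall_inP => j jAB; apply/implyP.
  have [_ _ ->] := Gz i; have [_ _ ->] := Gz j.
  move: iAB jAB; rewrite !inE /swap_fun.
  move: (tnth z i).1 (tnth z j).1 => x y.
  by case: (ltP x s) => xs; case: (ltP y s) => ys //=; case: (ltP x m) => xm //=;
    case: (ltP y m) => ym //= _ _; lra.
have := point_chain_le_LIS nt cAB; have := point_chain_le_LIS nt cAC.
have cardU (X Y : {set 'I_n}) : (forall i, ~~ ((i \in X) && (i \in Y))) ->
    #|X :|: Y| = (#|X| + #|Y|)%N.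
  move=> XY; rewrite cardsU (_ : X :&: Y = finset.set0) ?cards0 ?subn0 //.
  by apply/setP => i; rewrite !inE; exact/negbTE.
have dAB : #|A :|: B| = (#|A| + #|B|)%N.
  by apply: cardU => i; rewrite !inE /=; case: ltP.
have dAC : #|A :|: C| = (#|A| + #|C|)%N.
  apply: cardU => i; rewrite !inE /=; case: ltP => //= xs.
  by rewrite -ltNge; exact: lt_le_trans le_sm.
have dBC : #|B :|: C| = (#|B| + #|C|)%N.
  by apply: cardU => i; rewrite !inE /=; case: (ltP _ m); rewrite ?andbF.
have -> : [set i : 'I_n | (s <= (tnth z i).1)%R]%SET = (B :|: C)%SET.
  apply/setP => i; rewrite !inE; case: (ltP _ m) => xm; rewrite ?andbT ?orbF ?andbF //=.
  exact: le_trans xm.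
have : (n = #|A| + (#|B| + #|C|))%N.
  rewrite -dBC.
  rewrite -[LHS]card_ord -(cardsC A); congr (_ + _)%N.
  apply: eq_card => i; rewrite !inE.
  case: (ltP _ s) => xs; case: (ltP _ m) => xm //=.
  by have := lt_le_trans (lt_le_trans xs le_sm) xm; rewrite ltxx.
rewrite dAB dAC dBC.
by lia.
Qed.

(** If [3 LIS < 2n], then [generic_LIS] puts more than [2n/3] points at or beyond [s]. The union
    bound runs over the set [I] of their labels; [F I] leaves the other points free, so its
    probability is a pure power. *)
Lemma lower_tail_le :
  (Sample n mu [set t : 'S_n | ((LIS t)%:R < 2 / 3 * n%:R :> R)%R] <=
   \sum_(I : {set 'I_n} | (2 * n < 3 * #|I|)%N) ((1 - s) ^+ #|I|)%:E)%E.
Proof.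
move: (s_ge0) (le_sm) (m_le1) => s0 sm m1.
pose D := fst @^-1` `[s, +oo[%classic : set (R * R).
have mD : measurable D by rewrite -[X in measurable X]setTI; exact: measurable_fst.
have muD : mu D = (1 - s)%:E.
  rewrite swap_permuton_fst // (_ : _ `&` _ = `[s, 1[%classic).
    by rewrite lebesgue_itvco // (le_trans sm).
  apply/seteqP; split => x /=; rewrite !in_itv /= ?andbT; first by move=> [-> /andP[]].
  by move=> /andP[sx ->]; rewrite sx (le_trans s0).
pose F (I : {set 'I_n}) := [set z : n.-tuple (R * R) | forall i, (i \in I) -> D (tnth z i)].
pose big := [pred I : {set 'I_n} | (2 * n < 3 * #|I|)%N].
have mF I : measurable (F I).
  rewrite (_ : F I = [set z | forall i, (if i \in I then D else setT) (tnth z i)]).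
    by apply: (@measurable_box _ _ n (fun i => if i \in I then D else setT)) => i; case: ifP.
  apply/seteqP; split => z H i; first by case: ifP => // /H.
  by have := H i; case: ifP.
apply: (@le_trans _ _ (iid mu n (\bigcup_(I in [set` big]) F I))).
  apply: (le_iid_generic s_ge0 le_sm m_le1).
  - exact: measurable_LIS_event.
  - by apply: fin_bigcup_measurable => [|I _]; [exact: finite_finset|exact: mF].
  have count_lt (L N : nat) : (3 * L < 2 * n -> 2 * n <= 2 * L + N -> 2 * n < 3 * N)%N by lia.
  move=> z [/= Lz gz]; have := generic_LIS gz; move: Lz; rewrite small_LISE => Lz Hz.
  exists [set i : 'I_n | (s <= (tnth z i).1)%R]%SET; first exact: count_lt Lz Hz.
  by move=> i; rewrite inE /D /preimage /= in_itv /= andbT.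
apply: le_trans (measure_bigcup_pred_le _ (fun I _ => mF I)) _.
apply: lee_sum => I _; rewrite EFin_expe -muD le_eqVlt; apply/orP; left; apply/eqP.
exact: (iid_coords mu (mem I) mD).
Qed.

End upper_bound.

(** * Exponential rates and the numerical estimates *)

Section rates.
Context (R : realType).
Implicit Types (u : (\bar R)^nat) (l : \bar R).

Lemma limn_esup_le u l N : (forall n, (N <= n)%N -> (u n <= l)%E) -> (limn_esup u <= l)%E.
Proof.
move=> ul; apply: (@le_trans _ _ (ereal_sup (u @` [set n | (N <= n)%N]))).
  by apply: ereal_inf_lbound; exists [set n | (N <= n)%N] => //; exists N.
by apply: ge_ereal_sup => _ [n Nn <-]; exact: ul.
Qed.

Lemma limn_einf_ge u l N : (forall n, (N <= n)%N -> (l <= u n)%E) -> (l <= limn_einf u)%E.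
Proof.
move=> lu; rewrite /limn_einf leeNr; apply: (@limn_esup_le _ _ N) => n Nn.
by rewrite leeN2; exact: lu.
Qed.

Variable a : R.
Hypothesis a01 : 0 < a < 1.

Let lne_powK k n : (0 < n)%N -> ((n%:R^-1)%:E * lne (a ^+ (k * n))%:E)%E = (k%:R * ln a)%:E.
Proof.
case/andP: a01 => a0 _ n0.
rewrite lne_EFin ?exprn_gt0 // -EFinM lnXn // -[ln a *+ _]mulr_natl natrM; congr EFin.
have n0R : (n%:R : R) != 0 by rewrite pnatr_eq0 -lt0n.
by field.
Qed.

Lemma lower_tail_rate_le (mu : probability (R * R)%type R) beta k n : (0 < n)%N ->
  (Sample n mu [set t : 'S_n | ((LIS t)%:R < beta * n%:R :> R)%R] <= (a ^+ (k * n))%:E)%E ->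
  (lower_tail_rate mu beta n <= (k%:R * ln a)%:E)%E.
Proof.
case/andP: a01 => a0 _ n0 Sa; rewrite /lower_tail_rate -(lne_powK k n0).
apply: lee_wpmul2l; first by rewrite lee_fin invr_ge0.
(* Monotonicity of [lne] on [[0, +oo]] also covers a vanishing probability, whose logarithm is
   [-oo]. *)
by rewrite lee_lne // in_itv /= ?leey ?andbT // lee_fin exprn_ge0 // ltW.
Qed.

Lemma lower_tail_rate_ge (mu : probability (R * R)%type R) beta k n : (0 < n)%N ->
  ((a ^+ (k * n))%:E <= Sample n mu [set t : 'S_n | ((LIS t)%:R < beta * n%:R :> R)%R])%E ->
  ((k%:R * ln a)%:E <= lower_tail_rate mu beta n)%E.
Proof.
case/andP: a01 => a0 _ n0 Sa; rewrite /lower_tail_rate -(lne_powK k n0).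
apply: lee_wpmul2l; first by rewrite lee_fin invr_ge0.
by rewrite lee_lne // in_itv /= ?leey ?andbT // lee_fin exprn_ge0 // ltW.
Qed.

(** Since [3|I| > 2n], each term is at most [a ^+ (14 * n)]; there are at most [2 ^ n] terms, and
    [2 * a = 1] cancels this count against [a ^+ n]. *)
Lemma subset_sum_le (n : nat) : 2 * a = 1 ->
  \sum_(I : {set 'I_n} | (2 * n < 3 * #|I|)%N)
  (a ^+ 21) ^+ #|I| <= a ^+ (13 * n).
Proof.
case/andP: a01 => a0 a1 a2.
apply: (@le_trans _ _ (\sum_(I : {set 'I_n}) a ^+ (14 * n))).
  rewrite big_mkcond; apply: ler_sum => I _; case: ifP => [nI|_]; last by rewrite exprn_ge0 // ltW.
  rewrite -exprM; apply: ler_wiXn2l; rewrite ?ltW //; lia.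
rewrite sumr_const -cardsT -powersetT card_powerset cardsT card_ord.
rewrite (_ : (14 * n = n + 13 * n)%N) ?exprD; last by lia.
by rewrite -mulr_natl natrX mulrA -exprMn a2 expr1n mul1r.
Qed.

(** The exponent is [n + 21 * n./2], at most [11.5 n]. The factor [a] at even places is a crude
    lower bound for the mass [m]. *)
Lemma alternating_prod_ge (n : nat) :
  a ^+ (12 * n) <= \prod_(i < n) (if odd i then a ^+ 22 else a).
Proof.
case/andP: a01 => a0 a1.
suff -> : \prod_(i < n) (if odd i then a ^+ 22 else a) = a ^+ (n + 21 * n./2).
  apply: ler_wiXn2l; rewrite ?ltW //; have := odd_double_half n; lia.
elim: n => [|n IH]; first by rewrite big_ord0 expr0.
rewrite big_ord_recr /= IH; case: ifP => on.
  by rewrite -exprD; congr (_ ^+ _); rewrite uphalf_half on; lia.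
by rewrite -exprSr; congr (_ ^+ _); rewrite uphalf_half on; lia.
Qed.

End rates.

Theorem proposition2p8 (R : realType) :
  exists mu1 mu2 : probability (R * R)%type R,
    [/\ is_permuton mu1, is_permuton mu2, sht mu1 = sht mu2 &
      exists2 beta : R, (beta%:E < LISt mu1 1)%E &
        (limn_esup (lower_tail_rate mu2 beta) <
         limn_einf (lower_tail_rate mu1 beta))%E].
Proof.
pose a : R := 2^-1.
have a01 : 0 < a < 1 by rewrite /a; apply/andP; split; lra.
have a2 : 2 * a = 1 by rewrite /a mulfV // pnatr_eq0.
have /andP[a0 a1] := a01.
(* The exponent 22 separates the rates: about [(1 + 22) / 2 = 11.5], rounded up to 12, against
   [21 * 2 / 3 - 1 = 13]. With [1 - s = 2 * p], both swapped blocks have mass [p], and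
   [s + (1 - m) = m] is the boundary case of [long_m]. *)
pose p := a ^+ 22; pose m := 1 - p; pose s := 1 - a ^+ 21.
have p_gt0 : 0 < p by exact: exprn_gt0.
have a21E : a ^+ 21 = 2 * p.
  by rewrite /p [in RHS]exprS mulrA a2 mul1r.
have ple : p <= 1 / 8.
  apply: (@le_trans _ _ (a ^+ 3)); first by apply: ler_wiXn2l; rewrite ?ltW.
  by rewrite !exprS expr0 /a; lra.
have s0 : 0 <= s by rewrite /s a21E; lra.
have sm : s <= m by rewrite /s /m a21E; lra.
have m0 : 0 < m by rewrite /m; lra.
have m1 : m < 1 by rewrite /m; lra.
have sm' : s + (1 - m) <= m by rewrite /s /m a21E; lra.
have m0' : 0 + (1 - m) <= m by rewrite /m; lra.
exists (swap_permuton 0 m), (swap_permuton s m); split.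
- exact: swap_permuton_is_permuton (lexx 0) (ltW m0) (ltW m1).
- exact: swap_permuton_is_permuton s0 sm (ltW m1).
- by rewrite (sht_swap_permuton (lexx 0) (ltW m0) (ltW m1)) // sht_swap_permuton // ltW.
exists (2 / 3); first by rewrite (LIS1_swap_permuton (lexx 0) (ltW m0) (ltW m1)) // lte_fin /m; lra.
apply: (@le_lt_trans _ _ (13%:R * ln a)%:E).
  apply: (@limn_esup_le _ _ _ 1) => n n0; apply: (lower_tail_rate_le a01) => //.
  apply: le_trans (lower_tail_le n s0 sm (ltW m1)) _.
  by rewrite sumEFin lee_fin (_ : 1 - s = a ^+ 21) ?subset_sum_le // /s; lra.
apply: (@lt_le_trans _ _ (12%:R * ln a)%:E).
  (* As [ln a < 0], the larger factor 13 gives the smaller rate. *)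
  by rewrite lte_fin; have := ln_lt0 a01; lra.
apply: (@limn_einf_ge _ _ _ 7) => n n7; apply: (lower_tail_rate_ge a01); first exact: leq_trans n7.
apply: le_trans (lower_tail_ge m0 m1 n7).
rewrite (_ : (\prod_(i < n) _)%E = (\prod_(i < n) (if odd i then 1 - m else m))%:E); last first.
  by rewrite -prodEFin; apply: eq_bigr => i _; case: ifP.
rewrite lee_fin; apply: le_trans (alternating_prod_ge a01 n) _.
apply: ler_prod => i _; case: ifP => _.
  by rewrite ltW //= /m /p; lra.
by rewrite ltW //= /m; move: ple; rewrite /a; lra.
Qed.
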